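(* Let $\alpha,\beta$ be real and $n\ge0$ an integer such that the HR polynomials below are well-defined. Let $$\overline{L_1^*}=z^2(z-1)\partial_z^2-z(2+\alpha+(-3+\beta)z)\partial_z+(1-\beta)zI,\qquad \overline{L_2^*}=z(z-1)\partial_z+(-1-\alpha+z)I.$$ Then the following are quasi-polynomial eigenfunctions and eigenvalues of the adjoint generalized eigenvalue problem: for $j=1,2$, $$(\overline{L_1^*}-\mu^{(j)}_n\overline{L_2^*})\phi^{(j,n)*}(z)=0,\qquad \phi^{(j,n)*}(z)=w_j(z)\tilde p^{(j)}_n(z),$$ where $$w_1(z)=(1-z)^{\alpha+\beta}(-z)^{-1-\alpha},\quad\tilde p^{(1)}_n(z)=P_n(z;\beta-1,\alpha+1),\quad\mu^{(1)}_n=n;$$ $$w_2(z)=(-z)^{-1-\alpha},\quad\tilde p^{(2)}_n(z)=P_n(z;-\alpha-1,-\beta+1),\quad\mu^{(2)}_n=n-(\alpha+\beta).$$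
   Context: HR polynomials: $P_n(z;a,b)=\frac{(b)_n}{(a+1)_n}\,{}_2F_1(-n,a+1;1-b-n;z)$, $(a)_n$ the Pochhammer symbol; well-defined when $(a+1)_n\ne0$ and $b\notin\{0,-1,\ldots,1-n\}$. $\partial_z=d/dz$. Powers are taken with any fixed holomorphic branch on a domain avoiding the branch points. (The operators $\overline{L_i^*}$ are the formal adjoints, on the unit circle, of $L_1=z(1-z)\partial_z^2+(1-\beta-(2+\alpha)z)\partial_z$ and $L_2=(1-z)\partial_z-(\alpha+1)I$.) *)

(* Defs.v *)
From mathcomp Require Import all_boot all_order all_algebra.
From mathcomp Require Import all_classical all_reals all_analysis.
From mathcomp.real_closed Require Import complex.

Set Implicit Arguments.
Unset Strict Implicit.
Unset Printing Implicit Defensive.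

Import Order.TTheory GRing.Theory Num.Theory.
Import numFieldNormedType.Exports.

Local Open Scope classical_set_scope.
Local Open Scope ring_scope.

Section HRPolynomials.
Variable F : fieldType.

Definition poch (a : F) (n : nat) : F := \prod_(i < n) (a + i%:R).

(* 2F1(-n, b; c; z): the series stops at degree n because (-n)_k = 0 for
   k > n. It is meaningful only when c is none of 0, -1, ..., 1-n. *)
Definition hyp2F1_term (n : nat) (b c : F) : {poly F} :=
  \poly_(k < n.+1)
    (poch (- n%:R) k * poch b k / (poch c k * (k`!)%:R)).

Definition HR (n : nat) (a b : F) : {poly F} :=
  (poch b n / poch (a + 1) n) *: hyp2F1_term n (a + 1) (1 - b - n%:R).

Definition HR_well_defined (n : nat) (a b : F) : Prop :=
  poch (a + 1) n != 0 /\ (forall i : nat, (i < n)%N -> b != - i%:R).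

End HRPolynomials.

(* The alias keeps the canonical normed-module structure of the field on the
   carrier, so that [derivable _ _ 1] and [derive1] on [cplx R -> cplx R] are
   complex differentiability and the complex derivative. *)
Definition cplx (R : realType) : numClosedFieldType := R[i].

Definition ofreal (R : realType) (x : R) : cplx R := Complex x 0.

Definition cexp (R : realType) (z : cplx R) : cplx R :=
  Complex (expR (complex.Re z) * cos (complex.Im z))
          (expR (complex.Re z) * sin (complex.Im z)).

Section ComplexAnalysis.
Variable R : realType.
Local Notation C := (cplx R).

Definition domain (D : set C) : Prop := [/\ open D, connected D & D !=set0].

(* Intended for open D only. *)
Definition holomorphic_on (D : set C) (f : C -> C) : Prop :=
  forall z, D z -> derivable f z 1.

(* f is a holomorphic branch on D of the multivalued function g ^ s, whose
   values at z are the exp (s w) with exp w = g z. No branch of log g on D is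
   required, so that g ^ s with s an integer has a branch on any D on which g
   is holomorphic and does not vanish. *)
Definition power_branch (D : set C) (g : C -> C) (s : C) (f : C -> C) : Prop :=
  holomorphic_on D f /\
  (forall z, D z -> exists w : C, cexp w = g z /\ f z = cexp (s * w)).

Definition L1adj (alpha beta : C) (f : C -> C) (z : C) : C :=
  z ^+ 2 * (z - 1) * derive1 (derive1 f) z
  - z * (2 + alpha + (- 3 + beta) * z) * derive1 f z
  + (1 - beta) * z * f z.

Definition L2adj (alpha : C) (f : C -> C) (z : C) : C :=
  z * (z - 1) * derive1 f z + (- 1 - alpha + z) * f z.

(* (A - mu B) phi = 0 on D for second-order differential operators A and B.
   Holomorphy of phi and its derivative is part of the definition since
   [derive1] is total. *)
Definition generalized_eigenfunction (D : set C)
    (A B : (C -> C) -> C -> C) (mu : C) (phi : C -> C) : Prop :=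
  [/\ holomorphic_on D phi,
      holomorphic_on D (derive1 phi),
      exists2 z, D z & phi z != 0
    & forall z, D z -> A phi z - mu * B phi z = 0].

End ComplexAnalysis.

(* Main.v *)
(* A branch [f] of [h ^ s] with [s] real satisfies
   [ln |f|^2 = s * ln |h|^2]. Differentiating this identity along the real
   and imaginary directions compares the real parts of [f'/f] and [s h'/h],
   and of their products with [i], so [f' = s (h'/h) f] at each point, with no
   need for a local logarithm. Each weight [w] therefore has a rational
   logarithmic derivative [r]; factoring [w] out of the eigenvalue equation
   leaves a polynomial equation which is [-z] times the hypergeometric equation
   of the HR polynomial. *)

Require Import Defs.
From mathcomp Require Import all_boot all_order all_algebra.
From mathcomp Require Import all_classical all_reals all_analysis.
From mathcomp.real_closed Require Import complex.
From mathcomp Require Import ring.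

Set Implicit Arguments.
Unset Strict Implicit.
Unset Printing Implicit Defensive.

Import Order.TTheory GRing.Theory Num.Theory.
Import numFieldNormedType.Exports.

Local Open Scope classical_set_scope.
Local Open Scope ring_scope.

(** * Derivatives of a weight times a polynomial *)

Lemma is_derive_horner (K : numFieldType) (p : {poly K}) (x : K) :
  is_derive x 1 (horner p) (p^`()).[x].
Proof.
elim/poly_ind: p => [|p c ih].
  rewrite deriv0 horner0.
  have -> : horner (0 : {poly K}) = cst 0.
    by apply/funext => y; rewrite /= horner0.
  exact: is_derive_cst.
have -> : horner (p * 'X + c%:P) = horner p * id + cst c.
  by apply/funext => y; rewrite !fctE hornerMXaddC.
apply: is_derive_eq.
rewrite derivMXaddC hornerD hornerMX addr0 /GRing.scale /= mulr1.
by rewrite [x * _]mulrC.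
Qed.

Section WeightedPolynomial.
Variables (K : numFieldType) (D : set K) (w r r' : K -> K) (p : {poly K}).
Hypothesis Dopen : open D.
Hypothesis dw : forall z, D z -> is_derive z 1 w (r z * w z).
Hypothesis dr : forall z, D z -> is_derive z 1 r (r' z).

Local Notation phi := (fun z => w z * p.[z]).

Let psi := (w * (r * horner p + horner p^`())).

Lemma is_derive_weighted z : D z -> is_derive z 1 phi (psi z).
Proof.
move=> Dz; have := dw Dz => ?; have := @is_derive_horner _ p z => ?.
apply: (@is_derive_eq _ _ _ (w * horner p)).
by rewrite /psi !fctE /GRing.scale /=; ring.
Qed.

Lemma derive1_weighted z : D z -> derive1 phi z = psi z.
Proof. by move=> /is_derive_weighted H; rewrite derive1E derive_val. Qed.

(** From [w' = r w] one gets [w'' = (r ^ 2 + r') w], so [w] stays a common factor. The formula [psi]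
    for the first derivative is known only on [D]; openness of [D] lets it be differentiated
    again. *)
Lemma is_derive_derive1_weighted z : D z ->
  is_derive z 1 (derive1 phi)
    (w z * ((r z ^+ 2 + r' z) * p.[z] + r z * (p^`()).[z] *+ 2
            + (p^`()^`()).[z])).
Proof.
move=> Dz; apply: (@near_eq_is_derive _ _ _ psi).
  near=> y; rewrite derive1_weighted //; near: y.
  exact: open_nbhs_nbhs.
have := dw Dz => ?; have := dr Dz => ?.
have := @is_derive_horner _ p z => ?; have := @is_derive_horner _ p^`() z => ?.
apply: is_derive_eq.
by rewrite !fctE /GRing.scale /=; ring.
Unshelve. all: by end_near. Qed.

End WeightedPolynomial.

(** * Real derivatives along lines in the complex plane *)

Section RealDerivatives.
Variable R : realType.
Local Notation C := (cplx R).
Local Notation Re := complex.Re.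
Local Notation Im := complex.Im.

Definition sqnorm (x : C) : R := Re x ^+ 2 + Im x ^+ 2.

Lemma sqnorm_gt0 (x : C) : x != 0 -> 0 < sqnorm x.
Proof.
case: x => a b; rewrite eq_complex /= /sqnorm /= => ab.
rewrite lt0r addr_ge0 ?sqr_ge0 // andbT.
by rewrite paddr_eq0 ?sqr_ge0 // !sqrf_eq0.
Qed.

Lemma Re_div (x y : C) : Re (x / y) = (Re x * Re y + Im x * Im y) / sqnorm y.
Proof.
by case: x y => a b [c d]; rewrite /sqnorm /=; ring.
Qed.

Lemma Re_ofrealM (s : R) (x : C) : Re (ofreal s * x) = s * Re x.
Proof. by case: x => a b; rewrite /= mul0r subr0. Qed.

Lemma ReB (x y : C) : Re (x - y) = Re x - Re y.
Proof. by case: x y => a b [c d]. Qed.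

Lemma normr_Re (x : C) : `|Re x| <= Normc.normc x.
Proof.
case: x => a b /=; rewrite -sqrtr_sqr ler_sqrt ?addr_ge0 ?sqr_ge0 //.
by rewrite lerDl sqr_ge0.
Qed.

Lemma normcE (x : C) : `|x| = ofreal (Normc.normc x).
Proof. by case: x. Qed.

Lemma normc_ofreal (x : R) : Normc.normc (ofreal x) = `|x|.
Proof. by rewrite /= expr0n /= addr0 sqrtr_sqr. Qed.

Lemma ofreal_gt0 (x : R) : (0 < ofreal x :> C) = (0 < x).
Proof. by rewrite ltcE /= eqxx. Qed.

Lemma gt0_ofreal (x : C) : 0 < x -> exists2 y : R, 0 < y & x = ofreal y.
Proof.
by case: x => a b; rewrite ltcE /= => /andP[/eqP -> a0]; exists a.
Qed.

(** The real difference quotient at [t] is the real part of [v] times the complex difference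
    quotient at [h = t v], and [h] is nonzero when [t] is. *)
Lemma is_derive_Re_line (g : C -> C) (z dg v : C) : v != 0 ->
  is_derive z 1 g dg ->
  is_derive (0 : R) 1 (fun t => Re (g (ofreal t * v + z))) (Re (dg * v)).
Proof.
move=> v0 [gz gE].
pose q (h : C) : C := h^-1 *: (g (h *: 1 + z) - g z).
have qcvg : q h @[h --> 0^'] --> dg by rewrite -gE; exact: gz.
suff H : (t^-1 *: (Re (g (ofreal (t *: 1 + 0) * v + z))
           - Re (g (ofreal 0 * v + z)))) @[t --> (0 : R)^'] --> Re (dg * v).
  by apply: DeriveDef; [apply/cvg_ex; eexists; exact: H | exact: cvg_lim H].
have nv0 : 0 < Normc.normc v by rewrite -ofreal_gt0 -normcE normr_gt0.
apply/cvgrPdist_lt => e e0.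
(* The tolerance is divided by [|v|] because the quotient gets multiplied by [v]; the radius below
   is divided by [|v|] because [|h| = |t| |v|]. *)
have /cvgrPdist_lt/(_ (ofreal (e / Normc.normc v))) := qcvg.
rewrite ofreal_gt0 divr_gt0 // => /(_ isT) [d /= /gt0_ofreal[d' d'0 ->] Hd].
exists (d' / Normc.normc v) => /=; first by rewrite divr_gt0.
move=> t /=; rewrite sub0r normrN ltr_pdivlMr // => td t0.
have tv0 : ofreal t * v != 0.
  by rewrite mulf_neq0 // eq_complex /= eqxx andbT.
have := Hd (ofreal t * v).
rewrite /= sub0r normrN => /(_ _ tv0).
rewrite normcE ltcE /= eqxx /= Normc.normcM.
rewrite normc_ofreal.
move=> /(_ td).
rewrite normcE ltcE /= eqxx /= ltr_pdivlMr // -Normc.normcM => H.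
apply: le_lt_trans H; apply: le_trans (normr_Re _).
rewrite le_eqVlt; apply/orP; left; apply/eqP; congr `|_|.
rewrite mulrBl ReB; congr (_ - _).
rewrite /q /GRing.scale /= !mulr1 addr0.
have -> : ofreal 0 * v + z = z by rewrite -[ofreal 0]/(0 : C) mul0r add0r.
rewrite -ReB invfM mulrAC mulfVK //.
have -> : (ofreal t)^-1 = ofreal t^-1 :> C.
  apply/eqP; rewrite eq_complex /= mul0r oppr0 eqxx andbT expr0n /= addr0.
  by rewrite expr2 invfM mulrA mulfV // mul1r.
by rewrite -Re_ofrealM.
Qed.

End RealDerivatives.

(** * Logarithmic derivative of a power branch *)

Section PowerBranch.
Variable R : realType.
Local Notation C := (cplx R).
Local Notation Re := complex.Re.
Local Notation Im := complex.Im.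

(** The derivative of [|g|^2] along [v] is twice the real part of [dg v] times the conjugate of [g];
    dividing by [|g|^2] turns this into [2 Re (dg v / g)]. *)
Lemma is_derive_ln_sqnorm_line (g : C -> C) (z dg v : C) : v != 0 ->
  g z != 0 -> is_derive z 1 g dg ->
  is_derive (0 : R) 1 (fun t => ln (sqnorm (g (ofreal t * v + z))))
    (2 * Re (dg / g z * v)).
Proof.
move=> v0 gz0 gdg.
have line0 : ofreal 0 * v + z = z by rewrite -[ofreal 0]/(0 : C) mul0r add0r.
have dRe := is_derive_Re_line v0 gdg.
have dIm : is_derive (0 : R) 1 (fun t => Im (g (ofreal t * v + z)))
    (Im (dg * v)).
  (* The imaginary part of [g] is the real part of [- i g], so the lemma on real parts covers it
     too. *)
  have ImE (x : C) : Im x = Re ((- 'i%C : C) * x).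
    by case: x => a b /=; rewrite oppr0 mul0r sub0r mulN1r opprK.
  have dig : is_derive z 1 ((- 'i%C : C) \o* g) ((- 'i%C : C) * dg).
    by apply: DeriveDef; [exact: derivableM | rewrite deriveMr // derive_val].
  rewrite ImE mulrA.
  have -> : (fun t => Im (g (ofreal t * v + z))) =
            (fun t => Re (((- 'i%C : C) \o* g) (ofreal t * v + z))).
    by apply/funext => t; rewrite ImE /= mulrC.
  exact: is_derive_Re_line dig.
have dN : is_derive (0 : R) 1 (fun t => sqnorm (g (ofreal t * v + z)))
    (2 * (Re (dg * v) * Re (g z) + Im (dg * v) * Im (g z))).
  apply: (is_derive_eq (is_deriveD (is_deriveX 2 dRe) (is_deriveX 2 dIm))).
  by rewrite line0 /GRing.scale /= !expr1; ring.
rewrite mulrAC Re_div mulrA.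
have dln : is_derive (sqnorm (g (ofreal 0 * v + z))) 1 (@ln R)
    (sqnorm (g z))^-1.
  by rewrite line0; apply: is_derive1_ln; exact: sqnorm_gt0.
by rewrite mulrC; exact: is_derive1_comp.
Qed.

Lemma near_line (D : set C) (z v : C) : v != 0 -> nbhs z D ->
  \forall t \near (0 : R), D (ofreal t * v + z).
Proof.
move=> v0 /nbhs_ballP[d /= /gt0_ofreal[d' d'0 ->] Hd].
have nv0 : 0 < Normc.normc v by rewrite -ofreal_gt0 -normcE normr_gt0.
apply/nbhs_ballP; exists (d' / Normc.normc v) => /=; first by rewrite divr_gt0.
move=> t; rewrite /ball /= sub0r normrN ltr_pdivlMr // => td.
apply: Hd; rewrite /ball /= opprD addrCA subrr addr0 normrN.
by rewrite normcE ltcE /= eqxx /= Normc.normcM normc_ofreal.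
Qed.

Lemma sqnorm_cexp (w : C) : sqnorm (cexp w) = expR (Re w) ^+ 2.
Proof.
by rewrite /sqnorm /= !exprMn -mulrDr cos2Dsin2 mulr1.
Qed.

Lemma cexp_neq0 (w : C) : cexp w != 0.
Proof.
apply/eqP => w0; have := sqnorm_cexp w; rewrite w0 /sqnorm /= expr0n /= addr0.
by move/eqP; rewrite eq_sym sqrf_eq0 gt_eqF // expR_gt0.
Qed.

Lemma power_branch_neq0 (D : set C) (h f : C -> C) (s z : C) :
  power_branch D h s f -> D z -> h z != 0 /\ f z != 0.
Proof. by move=> [_ H] /H[w [<- ->]]; rewrite !cexp_neq0. Qed.

(** Since [|cexp w|^2 = exp (2 Re w)] and [Re (s w) = s Re w] for real [s], the pointwise choice of
    the logarithm [w] drops out. *)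
Lemma ln_sqnorm_power_branch (D : set C) (h f : C -> C) (s : R) (z : C) :
  power_branch D h (ofreal s) f -> D z ->
  ln (sqnorm (f z)) = s * ln (sqnorm (h z)).
Proof.
move=> [_ H] /H[w [<- ->]]; rewrite !sqnorm_cexp Re_ofrealM.
by rewrite !lnXn ?expR_gt0 // !expRK mulrnAr.
Qed.

(** A branch is holomorphic by definition, so only the value of its derivative has to be
    identified. *)
Lemma is_derive_power_branch (D : set C) (h f : C -> C) (s : R) (z dh : C) :
  open D -> power_branch D h (ofreal s) f -> D z -> is_derive z 1 h dh ->
  is_derive z 1 f (ofreal s * (dh / h z) * f z).
Proof.
move=> Dopen fh Dz hdh.
have [hz0 fz0] := power_branch_neq0 fh Dz.
have fz : derivable f z 1 by exact: fh.1.
have /derivableP := fz; set df := 'D_1 f z => fdf.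
suff -> : ofreal s * (dh / h z) * f z = df by [].
suff E : df / f z = ofreal s * (dh / h z) by rewrite -E divfK.
have key v : v != 0 ->
    Re (df / f z * v) = Re (ofreal s * (dh / h z) * v).
  move=> v0; have Lf := is_derive_ln_sqnorm_line v0 fz0 fdf.
  have Lh := is_derive_ln_sqnorm_line v0 hz0 hdh.
  have Lsh : is_derive (0 : R) 1
      (s \*o (fun t => ln (sqnorm (h (ofreal t * v + z)))))
      (s * (2 * Re (dh / h z * v))).
    by apply: DeriveDef; [exact: derivableM | rewrite deriveMl // derive_val].
  (* The identity between logarithms holds on [D], hence for small [t], so both sides have the same
     derivative at 0. *)
  have near_eq : \forall t \near (0 : R),
      (s \*o (fun t => ln (sqnorm (h (ofreal t * v + z))))) t =
      ln (sqnorm (f (ofreal t * v + z))).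
    near=> t; rewrite /= -(ln_sqnorm_power_branch fh) //.
    by near: t; apply: near_line => //; exact: open_nbhs_nbhs.
  have [_] := near_eq_is_derive near_eq Lsh.
  case: Lf => _ ->; rewrite mulrCA => /mulfI ->; rewrite ?pnatr_eq0 //.
  by rewrite -[ofreal s * _ * v]mulrA Re_ofrealM.
(* The direction 1 compares real parts; the direction [i] compares imaginary parts, as
   [Re (x i) = - Im x]. *)
have := key 1 (oner_neq0 _); rewrite !mulr1.
have i0 : 'i%C != 0 :> C by rewrite eq_complex /= oner_eq0 andbF.
have := key 'i%C i0.
case: (df / f z) (ofreal s * (dh / h z)) => a b [c d] /=.
by rewrite !mulr0 !mulr1 !sub0r => /oppr_inj -> ->.
Unshelve. all: by end_near. Qed.

End PowerBranch.

(** * The hypergeometric equation *)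

Lemma pochS (F : fieldType) (x : F) (k : nat) :
  poch x k.+1 = poch x k * (x + k%:R).
Proof. by rewrite /poch big_ord_recr. Qed.

Lemma poch_neq0 (F : fieldType) (x : F) (k : nat) :
  (forall i, (i < k)%N -> x + i%:R != 0) -> poch x k != 0.
Proof. by move=> H; apply/prodf_neq0 => i _; exact: H. Qed.

Section Hypergeometric.
Variables (K : numFieldType) (n : nat) (b c : K).
Hypothesis c_neq : forall i, (i < n)%N -> c + i%:R != 0.
Local Notation p := (hyp2F1_term n b c).

(** This is the ratio of consecutive coefficients with denominators cleared, so that it holds for
    every [k]: at [k = n] the factor [k - n] vanishes along with the next coefficient, and beyond
    [n] both coefficients are 0. *)
Lemma hyp2F1_recurrence k :
  k.+1%:R * (c + k%:R) * p`_k.+1 = (k%:R - n%:R) * (b + k%:R) * p`_k.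
Proof.
rewrite !coef_poly !ltnS.
case: (ltngtP k n) => [kn|kn|->].
- rewrite factS natrM !pochS.
  have ck : poch c k != 0.
    by apply: poch_neq0 => i ik; apply: c_neq; exact: ltn_trans kn.
  have := c_neq kn => ckn.
  by field; rewrite ckn ck nat1r !pnatr_eq0 -lt0n fact_gt0.
- by rewrite !mulr0.
- by rewrite subrr !mulr0 !mul0r.
Qed.

(** The coefficient of [X^k] on the left is the difference of the two sides of the recurrence at
    [k]. *)
Lemma hyp2F1_ode :
  'X * (1 - 'X) * p^`()^`() + (c%:P - (b - n%:R + 1)%:P * 'X) * p^`()
    + (n%:R * b)%:P * p = 0.
Proof.
move: (hyp2F1_term n b c) hyp2F1_recurrence => q rec.
have -> : 'X * (1 - 'X) * q^`()^`() + (c%:P - (b - n%:R + 1)%:P * 'X) * q^`()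
    + (n%:R * b)%:P * q = 'X * q^`()^`() - 'X * ('X * q^`()^`())
    + c%:P * q^`() - (b - n%:R + 1)%:P * ('X * q^`()) + (n%:R * b)%:P * q
  by ring.
apply/polyP => k.
rewrite !(coefD, coefB, coefN, coefCM, coefXM, coef0).
(* The degrees 0 and 1 are separate because the double shift by ['X] gives coefficient 0 there. *)
have := rec k; case: k => [|[|k]] /= /eqP; rewrite -subr_eq0 => /eqP reck;
  apply: etrans reck; rewrite !coef_deriv; ring.
Qed.

End Hypergeometric.

(** * The differential equation of the HR polynomials *)

Section HRPolynomials.
Variables (K : numFieldType) (n : nat) (a b : K).
Hypothesis wd : HR_well_defined n a b.
Local Notation p := (HR n a b).

Let c_neq i : (i < n)%N -> 1 - b - n%:R + i%:R != 0.
Proof.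
(* A zero here would force [b = - (n - i - 1)], an excluded value. *)
move=> ni; apply: contra_neq (wd.2 (n - i.+1)%N _) => [E|].
  apply/eqP; rewrite -subr_eq0 natrB // -natr1 -[eqbRHS]oppr0 -E.
  by apply/eqP; ring.
by rewrite ltn_subrL; case: (n) ni.
Qed.

Lemma HR_ode x :
  x * (1 - x) * p^`()^`().[x]
    + (1 - b - n%:R - (a + 1 - n%:R + 1) * x) * p^`().[x]
    + n%:R * (a + 1) * p.[x] = 0.
Proof.
have ode := hyp2F1_ode (a + 1) c_neq.
rewrite /HR; move: (hyp2F1_term _ _ _) ode => q /(congr1 (horner^~ x)).
rewrite !(hornerD, hornerN, hornerM, hornerX, hornerC) => ode.
rewrite !derivZ !hornerZ; set k := poch b n / _.
by rewrite -[RHS](mulr0 k) -ode; ring.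
Qed.

(** The hypergeometric factor has constant term 1, and well-definedness makes both Pochhammer
    symbols of the prefactor nonzero. *)
Lemma HR_neq0 : p != 0.
Proof.
rewrite /HR scaler_eq0 negb_or mulf_neq0 ?invr_neq0 ?wd.1 //=.
  apply/eqP => /polyP /(_ 0); rewrite coef_poly /poch !big_ord0 coef0.
  by rewrite !mulr1 divr1 => /eqP; rewrite oner_eq0.
by apply: poch_neq0 => i ni; rewrite addr_eq0 wd.2.
Qed.

End HRPolynomials.

(** * From the polynomial equation to the eigenfunctions *)

(** A ball inside [D] contains [size p] distinct points, more than [p] has roots. This supplies the
    point where an eigenfunction is nonzero. *)
Lemma open_nonroot (K : numFieldType) (D : set K) (p : {poly K}) :
  open D -> D !=set0 -> p != 0 -> exists2 z, D z & p.[z] != 0.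
Proof.
move=> Dopen [z0 Dz0] p0; apply: contrapT => noz.
have [d /= d0 Hd] := (nbhs_ballP _ _).1 (open_nbhs_nbhs (conj Dopen Dz0)).
(* Denominators start at 2 to keep the points strictly inside the ball of radius [d]. *)
pose s := [seq z0 - d / k.+2%:R | k <- iota 0 (size p)].
have := max_poly_roots p0 (rs := s).
rewrite size_map size_iota ltnn => H; suff: false by []; apply: H.
  apply/allP => _ /mapP[k _ ->]; apply/rootP/eqP; apply: contrapT => /negP nz.
  apply: noz; exists (z0 - d / k.+2%:R) => //; apply: Hd.
  rewrite /ball /= opprD addrA subrr sub0r opprK ger0_norm ?divr_ge0 ?ltW //.
  by rewrite ltr_pdivrMr ?ltr0n // ltr_pMr // ltr1n.
rewrite map_inj_uniq ?iota_uniq // => k l /addrI /oppr_inj.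
by move=> /(mulfI (lt0r_neq0 d0)) /invr_inj/eqP; rewrite eqr_nat => /eqP[].
Qed.

(** The last hypothesis is the eigenvalue equation for [w p] with the factor [w] divided out. *)
Lemma weighted_eigenfunction (R : realType) (D : set (cplx R))
    (w r r' : cplx R -> cplx R) (p : {poly cplx R}) (alpha beta mu : cplx R) :
  open D -> D !=set0 -> p != 0 -> (forall z, D z -> w z != 0) ->
  (forall z, D z -> is_derive z 1 w (r z * w z)) ->
  (forall z, D z -> is_derive z 1 r (r' z)) ->
  (forall z, D z ->
     z ^+ 2 * (z - 1) * ((r z ^+ 2 + r' z) * p.[z] + r z * p^`().[z] *+ 2
                         + p^`()^`().[z])
     - (z * (2 + alpha + (- 3 + beta) * z) + mu * (z * (z - 1)))
       * (r z * p.[z] + p^`().[z])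
     + ((1 - beta) * z - mu * (- 1 - alpha + z)) * p.[z] = 0) ->
  generalized_eigenfunction D (L1adj alpha beta) (L2adj alpha) mu
    (fun z => w z * p.[z]).
Proof.
move=> Dopen D0 p0 w0 dw dr ode; split.
- by move=> z Dz; have ? := is_derive_weighted p dw Dz; exact: ex_derive.
- move=> z Dz.
  have ? := is_derive_derive1_weighted p Dopen dw dr Dz; exact: ex_derive.
- have [z Dz pz] := open_nonroot Dopen D0 p0.
  by exists z => //; rewrite mulf_neq0 ?w0.
move=> z Dz; rewrite /L1adj /L2adj (derive1_weighted p dw Dz).
have := is_derive_derive1_weighted p Dopen dw dr Dz.
rewrite [derive1 (derive1 _) z]derive1E => -[_ ->].
by rewrite !fctE -[RHS](mulr0 (w z)) -(ode z Dz); ring.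
Qed.

(** The weights have logarithmic derivatives that are sums of such simple fractions, with poles at 0
    and 1. *)
Lemma is_derive_div_shift (K : numFieldType) (s c z : K) : z - c != 0 ->
  is_derive z 1 (fun y => s / (y - c)) (- s / (z - c) ^+ 2).
Proof.
move=> zc.
have dsub : is_derive z (1 : K) (id - cst c) 1.
  by apply: is_derive_eq; rewrite subr0.
have dV : is_derive z 1 (fun y => (y - c)^-1) (- (z - c) ^- 2).
  apply: DeriveDef; first exact: (@derivableV _ _ (id - cst c)).
  rewrite (@deriveV _ _ (id - cst c)) // derive_val.
  by rewrite /GRing.scale /= mulr1.
apply: (@is_derive_eq _ _ _ (cst s * (fun y => (y - c)^-1))).
by rewrite /GRing.scale /= mulr0 addr0 mulrN mulNr.
Qed.

Theorem proposition3p5 (R : realType) (alpha beta : R) (n : nat)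
    (a := ofreal alpha) (b := ofreal beta)
    (wd1 : HR_well_defined n (b - 1) (a + 1))
    (wd2 : HR_well_defined n (- a - 1) (- b + 1)) :
  (forall (D : set (cplx R)) (f g : cplx R -> cplx R),
     domain D -> ~ D 0 -> ~ D 1 ->
     power_branch D (fun z => 1 - z) (a + b) f ->
     power_branch D (fun z => - z) (- 1 - a) g ->
     generalized_eigenfunction D (L1adj a b) (L2adj a) n%:R
       (fun z => f z * g z * (HR n (b - 1) (a + 1)).[z])) /\
  (forall (D : set (cplx R)) (g : cplx R -> cplx R),
     domain D -> ~ D 0 ->
     power_branch D (fun z => - z) (- 1 - a) g ->
     generalized_eigenfunction D (L1adj a b) (L2adj a) (n%:R - (a + b))
       (fun z => g z * (HR n (- a - 1) (- b + 1)).[z])).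
Proof.
have abE : a + b = ofreal (alpha + beta).
  by apply/eqP; rewrite eq_complex /= addr0 !eqxx.
have aE : - 1 - a = ofreal (- 1 - alpha).
  by apply/eqP; rewrite eq_complex /= !oppr0 addr0 !eqxx.
(* The denominator is written [z - 0] to match the shifted fraction with [c = 0]. *)
have dg (D : set (cplx R)) (g : cplx R -> cplx R) z : open D -> ~ D 0 ->
    power_branch D (fun z => - z) (- 1 - a) g -> D z ->
    z != 0 /\ is_derive z 1 g ((- 1 - a) / (z - 0) * g z).
  move=> Dopen D0 gb Dz; have z0 : z != 0 by apply/eqP => z0; rewrite -z0 in D0.
  split=> //; rewrite aE in gb *.
  have := is_derive_power_branch Dopen gb Dz (is_deriveNid z 1).
  by rewrite invrN mulrNN mul1r subr0.
split.
- move=> D f g [Dopen _ Dne] D0 D1 fb gb.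
  have z1 z : D z -> z - 1 != 0.
    by move=> Dz; apply/eqP => /subr0_eq z1; rewrite -z1 in D1.
  have df z : D z -> is_derive z 1 f ((a + b) / (z - 1) * f z).
    move=> Dz; rewrite abE in fb *.
    have d1z : is_derive z 1 (cst 1 - id : cplx R -> cplx R) (- 1).
      by apply: is_derive_eq; rewrite sub0r.
    have := is_derive_power_branch Dopen fb Dz d1z.
    by rewrite -[1 - z]opprB invrN mulrNN mul1r.
  (* The logarithmic derivative of the product [f g] is the sum of those of its factors. *)
  apply: (@weighted_eigenfunction R D (fun z => f z * g z)
    (fun z => (a + b) / (z - 1) + (- 1 - a) / (z - 0))
    (fun z => - (a + b) / (z - 1) ^+ 2 + - (- 1 - a) / (z - 0) ^+ 2)
    _ a b _ Dopen Dne).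
  + exact: HR_neq0.
  + move=> z Dz; have [_ fz] := power_branch_neq0 fb Dz.
    by have [_ gz] := power_branch_neq0 gb Dz; rewrite mulf_neq0.
  + move=> z Dz; have ? := df z Dz; have [_ ?] := dg D g z Dopen D0 gb Dz.
    apply: (@is_derive_eq _ _ _ (f * g)).
    by rewrite /GRing.scale /=; ring.
  + move=> z Dz; have [z0 _] := dg D g z Dopen D0 gb Dz.
    apply: is_deriveD; apply: is_derive_div_shift; rewrite ?subr0 //.
    exact: z1.
  + move=> z Dz; have [z0 _] := dg D g z Dopen D0 gb Dz.
    have zm1 := z1 z Dz; have ode := HR_ode wd1 z.
    (* The exponent [a + b] cancels the pole at 1 in the coefficient of the polynomial, and
       [- 1 - a] makes that coefficient divisible by [z]. *)
    by rewrite subr0 -[RHS](mulr0 (- z)) -ode; field; rewrite z0 zm1.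
- move=> D g [Dopen _ Dne] D0 gb.
  apply: (@weighted_eigenfunction R D g (fun z => (- 1 - a) / (z - 0))
    (fun z => - (- 1 - a) / (z - 0) ^+ 2)
    _ a b _ Dopen Dne).
  + exact: HR_neq0.
  + by move=> z Dz; have [_ gz] := power_branch_neq0 gb Dz.
  + by move=> z Dz; have [] := dg D g z Dopen D0 gb Dz.
  + move=> z Dz; have [z0 _] := dg D g z Dopen D0 gb Dz.
    by apply: is_derive_div_shift; rewrite subr0.
  + move=> z Dz; have [z0 _] := dg D g z Dopen D0 gb Dz.
    have ode := HR_ode wd2 z.
    by rewrite subr0 -[RHS](mulr0 (- z)) -ode; field.
Qed.
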